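(* Let $l,l'\ge 1$ be natural numbers, let $r_1,\dots,r_l\in\mathbb{C}$ and let $s_1,\dots,s_{l'}\in\mathbb{C}\setminus\{0\}$. Let $\mathbb{B}=\mathbb{B}(r_1,\dots,r_l;s_1,\dots,s_{l'})$, acting as a bounded linear operator on $c_0$. Then the continuous spectrum of $\mathbb{B}$ is $$\sigma_c(\mathbb{B},c_0)=\left\{\lambda\in\mathbb{C}: (|\lambda-r_1|\cdots|\lambda-r_l|)^{1/l}= (|s_1|\cdots|s_{l'}|)^{1/l'}\right\}.$$
   Context: $c_0$ is the Banach space of complex sequences $x=(x_k)_{k\ge 0}$ converging to $0$, with the supremum norm. For an integer $a$ and $n\in\mathbb{N}$, $a\,(\mathrm{mod}\ n)$ denotes the remainder in $\{0,\dots,n-1\}$ of $a$ modulo $n$. The matrix $\mathbb{B}(r_1,\dots,r_l;s_1,\dots,s_{l'})=(b_{ij})_{i,j\ge 0}$ is the infinite lower triangular matrix with $b_{ij}=r_{j(\mathrm{mod}\ l)+1}$ if $i=j$, $b_{ij}=s_{j(\mathrm{mod}\ l')+1}$ if $i=j+1$, and $b_{ij}=0$ otherwise; it acts on $x=(x_k)_{k\ge0}$ by $(\mathbb{B}x)_k=s_{(k-1)(\mathrm{mod}\ l')+1}x_{k-1}+r_{k(\mathrm{mod}\ l)+1}x_k$, with $x_{-1}=0$. The continuous spectrum $\sigma_c(T,X)$ is the set of $\lambda\in\mathbb{C}$ for which $T-\lambda I$ is injective on $X$ and has dense range, but the inverse $(T-\lambda I)^{-1}$ (defined on the range) is not bounded.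 *)

(* Defs.v *)
From HB Require Import structures.
From mathcomp Require Import all_boot all_order all_algebra.
From mathcomp Require Export complex.
From mathcomp Require Import all_classical all_reals all_analysis.

Set Implicit Arguments.
Unset Strict Implicit.
Unset Printing Implicit Defensive.

Import Order.TTheory GRing.Theory Num.Theory.
Import numFieldNormedType.Exports.

Local Open Scope classical_set_scope.
Local Open Scope ring_scope.
Local Open Scope complex_scope.

(* [R[i]] gets the topology induced by its modulus, as any [numFieldType]. *)
HB.instance Definition _ (R : rcfType) := NormedModule.copy R[i] R[i]^o.

(* The real-valued modulus; [`|z|] is the same number seen in [R[i]]. *)
Notation cmod := Normc.normc.

Lemma normr_cmod (R : rcfType) (z : R[i]) : `|z| = (cmod z)%:C.
Proof. by []. Qed.

Lemma cmod_ge0 (R : rcfType) (z : R[i]) : 0 <= cmod z.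
Proof. by case: z => a b; exact: sqrtr_ge0. Qed.

Section ContinuousSpectrum.
Variables (K : numFieldType) (X : normedModType K).

(* [pinv setT S] is the inverse of the injective map [S] on its range. *)
Definition bounded_inverse (S : X -> X) : Prop :=
  exists M : K, forall y, range S y -> `|pinv setT S y| <= M * `|y|.

Definition continuous_spectrum (T : {linear X -> X}) : set K :=
  [set lambda | let S := fun x : X => T x - lambda *: x in
    [/\ injective S, dense (range S) & ~ bounded_inverse S]].

End ContinuousSpectrum.

Section NullSequences.
Variable K : numFieldType.

Lemma null_seqD (x y : nat -> K) :
  x @ \oo --> 0 -> y @ \oo --> 0 -> (x \+ y) @ \oo --> 0.
Proof. by move=> x0 y0; rewrite -(addr0 0); exact: cvgD. Qed.

Lemma null_seqZ (a : K) (x : nat -> K) :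
  x @ \oo --> 0 -> (fun n => a * x n) @ \oo --> 0.
Proof. by move=> x0; rewrite -(mulr0 a); apply: cvgM => //; exact: cvg_cst. Qed.

Lemma null_seq_bounded (x : nat -> K) :
  x @ \oo --> 0 -> exists M : K, forall n, `|x n| <= M.
Proof.
move=> x0; have /cvg_seq_bounded : cvgn x by apply/cvg_ex; exists 0.
by move/pinfty_ex_gt0 => [M _ xM]; exists M => n; exact: xM.
Qed.

Lemma null_seqM (w x : nat -> K) (M : K) :
  (forall n, `|w n| <= M) -> x @ \oo --> 0 -> (fun n => w n * x n) @ \oo --> 0.
Proof.
move=> wM x0; have M0 : 0 <= M := le_trans (normr_ge0 (w 0%N)) (wM 0%N).
have M1 : 0 < M + 1 by rewrite ltr_wpDl.
apply/cvgr0Pnorm_lt => e e0.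
have /cvgr0Pnorm_lt/(_ (e / (M + 1))) := x0.
rewrite divr_gt0// => /(_ isT) xe; near=> n.
rewrite normrM (@le_lt_trans _ _ ((M + 1) * `|x n|))//.
  by rewrite ler_wpM2r// (le_trans (wM n))// lerDl.
by rewrite mulrC -ltr_pdivlMr//; near: n.
Unshelve. all: by end_near. Qed.

End NullSequences.

Section CZero.
Variable R : realType.
Local Notation C := R[i].

Definition c0_pred : {pred nat -> C} :=
  mem [set x : nat -> C | x @ \oo --> (0 : C)].

Lemma c0_predE (x : nat -> C) : (x \in c0_pred) = (x @ \oo --> (0 : C)) :> Prop.
Proof. by rewrite /c0_pred; apply/propext; split => [/set_mem|/mem_set]. Qed.

Lemma c0_submod_closed : submod_closed c0_pred.
Proof.
split; first by rewrite c0_predE; exact: cvg_cst.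
move=> a x y; rewrite !c0_predE => x0 y0.
exact: (null_seqD (null_seqZ a x0) y0).
Qed.

HB.instance Definition _ :=
  GRing.isSubmodClosed.Build C (nat -> C) c0_pred c0_submod_closed.

Record c0 := C0 { c0_seq :> nat -> C; c0P : c0_seq \in c0_pred }.

HB.instance Definition _ := [isSub for c0_seq].
HB.instance Definition _ := [Choice of c0 by <:].
HB.instance Definition _ := [SubChoice_isSubLmodule of c0 by <:].

Lemma c0_cvg (x : c0) : x @ \oo --> (0 : C).
Proof. by rewrite -c0_predE; exact: c0P. Qed.

Definition c0_sup (x : c0) : R := sup (range (fun k => cmod (x k))).

Lemma c0_has_sup (x : c0) : has_sup (range (fun k => cmod (x k))).
Proof.
split; first by exists (cmod (x 0%N)), 0%N.
have [M xM] := null_seq_bounded (c0_cvg x).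
exists (complex.Re M) => _ [k _ <-].
by have := xM k; rewrite normr_cmod lecE => /andP[].
Qed.

Lemma c0_sup_ub (x : c0) k : cmod (x k) <= c0_sup x.
Proof. by apply: sup_upper_bound; [exact: c0_has_sup|exists k]. Qed.

Lemma c0_sup_le (x : c0) (M : R) :
  (forall k, cmod (x k) <= M) -> c0_sup x <= M.
Proof.
move=> xM; apply: ge_sup; first by case: (c0_has_sup x).
by move=> _ [k _ <-].
Qed.

Lemma c0_sup_ge0 (x : c0) : 0 <= c0_sup x.
Proof. by apply: le_trans (c0_sup_ub x 0%N); exact: cmod_ge0. Qed.

Let c0_norm (x : c0) : C := (c0_sup x)%:C.

Let c0_normD (x y : c0) : c0_norm (x + y) <= c0_norm x + c0_norm y.
Proof.
rewrite /c0_norm -rmorphD lecR; apply: c0_sup_le => k.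
rewrite -lecR -normr_cmod (le_trans (ler_normD _ _))// !normr_cmod.
by rewrite -rmorphD lecR lerD// c0_sup_ub.
Qed.

Let c0_normZ (a : C) (x : c0) : c0_norm (a *: x) = `|a| * c0_norm x.
Proof.
have le (b : C) (y : c0) : c0_norm (b *: y) <= `|b| * c0_norm y.
  rewrite /c0_norm normr_cmod -rmorphM lecR; apply: c0_sup_le => k.
  rewrite -lecR -normr_cmod normrM !normr_cmod -rmorphM lecR ler_wpM2l//.
    exact: cmod_ge0.
  exact: c0_sup_ub.
apply/eqP; rewrite eq_le le /=.
have [->|a0] := eqVneq a 0.
  by rewrite normr0 mul0r scale0r lecR c0_sup_ge0.
have := le a^-1 (a *: x).
by rewrite scalerA mulVf// scale1r normfV ler_pdivlMl// normr_gt0.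
Qed.

Let c0_norm_eq0 (x : c0) : c0_norm x = 0 -> x = 0.
Proof.
case=> x0; apply/val_inj/funext => k /=; apply/eqP.
rewrite -normr_eq0 eq_le normr_ge0 andbT normr_cmod.
by rewrite (_ : 0 = 0%:C)// lecR -x0 c0_sup_ub.
Qed.

HB.instance Definition _ :=
  Lmodule_isNormed.Build C c0 c0_normD c0_normZ c0_norm_eq0.

Lemma c0_normE (x : c0) : `|x| = (sup (range (fun k => cmod (x k))))%:C.
Proof. by []. Qed.

Lemma c0_norm_ub (x : c0) k : `|x k| <= `|x|.
Proof. by rewrite c0_normE normr_cmod lecR; exact: c0_sup_ub. Qed.

Lemma c0_norm_le (x : c0) (M : C) : (forall k, `|x k| <= M) -> `|x| <= M.
Proof.
move=> xM; rewrite c0_normE lecE /=.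
have := xM 0%N; rewrite normr_cmod lecE => /andP[-> _] /=.
by apply: c0_sup_le => k; have := xM k; rewrite normr_cmod lecE => /andP[].
Qed.

End CZero.

Section PeriodicBidiagonal.
Variables (R : realType) (l l' : nat).
Local Notation C := R[i].
Variables (r : l.-tuple C) (s : l'.-tuple C).

(* Tuples are numbered from 0, so [r`_(j %% l)] is r_(j (mod l) + 1). *)
Definition bidiag_mx (i j : nat) : C :=
  if i == j then r`_(j %% l) else if i == j.+1 then s`_(j %% l') else 0.

(* The product of [bidiag_mx] with the column [x]: see [bidiag_actE]. *)
Definition bidiag_act (x : nat -> C) (k : nat) : C :=
  (if k is j.+1 then s`_(j %% l') * x j else 0) + r`_(k %% l) * x k.

Lemma bidiag_actE (x : nat -> C) (k n : nat) : (k < n)%N ->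
  \sum_(j < n) bidiag_mx k j * x j = bidiag_act x k.
Proof.
move=> kn; rewrite -(big_mkord xpredT (fun j => bidiag_mx k j * x j)).
rewrite (big_cat_nat (n := k.+1))//= [X in _ + X](_ : _ = 0) ?addr0; last first.
  rewrite big_nat_cond big1// => j; rewrite andbT => /andP[kj _].
  by rewrite /bidiag_mx !ltn_eqF ?mul0r// ltnW.
rewrite big_nat_recr//= {2}/bidiag_mx eqxx /bidiag_act; congr (_ + _).
case: k kn => [|k] kn; first by rewrite big_geq.
rewrite big_nat_recr//= /bidiag_mx eqxx gtn_eqF// big_nat_cond big1 ?add0r//.
move=> j; rewrite andbT => /= jk.
by rewrite !gtn_eqF ?mul0r// ltnS// ltnW.
Qed.

Lemma periodic_bounded n (t : n.-tuple C) (k : nat) :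
  `|t`_(k %% n)| <= \sum_(z <- t) `|z|.
Proof.
have [kn|kn] := ltnP (k %% n)%N (size t); last first.
  by rewrite nth_default// normr0 sumr_ge0.
by rewrite (big_nth 0) big_mkord (bigD1 (Ordinal kn))//= lerDl sumr_ge0.
Qed.

Lemma bidiag_act_c0 (x : c0 R) : bidiag_act x \in @c0_pred R.
Proof.
rewrite c0_predE.
apply: (@null_seqD _ (fun k => if k is j.+1 then s`_(j %% l') * x j else 0)).
  by rewrite -cvg_shiftS; exact: (null_seqM (periodic_bounded s) (c0_cvg x)).
exact: (null_seqM (periodic_bounded r) (c0_cvg x)).
Qed.

Definition bidiag_op (x : c0 R) : c0 R := C0 (bidiag_act_c0 x).

Lemma bidiag_op_linear : linear bidiag_op.
Proof.
move=> a x y; apply/val_inj/funext => k.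
transitivity (a * bidiag_act x k + bidiag_act y k); last by [].
have : forall j, (a *: x + y) j = a * x j + y j by [].
move: (a *: x + y) => z zE; rewrite /= /bidiag_act zE mulrDr.
case: k => [|k]; first by rewrite !add0r mulrCA.
by rewrite zE !mulrDr !(mulrCA _ a) addrACA.
Qed.

HB.instance Definition _ :=
  GRing.isLinear.Build C (c0 R) (c0 R) _ bidiag_op bidiag_op_linear.

Lemma bidiag_op_continuous : continuous bidiag_op.
Proof.
pose m := \sum_(z <- s) `|z| + \sum_(z <- r) `|z|.
have sr_ge0 n (t : n.-tuple C) : 0 <= \sum_(z <- t) `|z| by rewrite sumr_ge0.
have bnd (x : c0 R) : `|bidiag_op x| <= m * `|x|.
  apply: c0_norm_le => k; rewrite /= /bidiag_act mulrDl.
  apply: le_trans (ler_normD _ _) _; apply: lerD.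
    case: k => [|k]; first by rewrite normr0 mulr_ge0.
    by rewrite normrM ler_pM// ?periodic_bounded ?c0_norm_ub.
  by rewrite normrM ler_pM// ?periodic_bounded ?c0_norm_ub.
apply/linear_bounded_continuous/linear_boundedP; near=> M => x.
apply: le_trans (bnd x) _; rewrite ler_wpM2r//; near: M.
by apply: nbhs_pinfty_ge; rewrite ger0_real// addr_ge0.
Unshelve. all: by end_near. Qed.

End PeriodicBidiagonal.

(* Main.v *)
(* Write T for the operator minus lambda, with diagonal a_k and subdiagonal
   b_k, and let y be the solution of the adjoint equation
   a_k y_k + b_k y_{k+1} = 0, y_0 = 1.  Then
     y_n a_n x_n = sum_{k <= n} y_k (T x)_k,
   and, if alpha > 0, |y_k| is comparable to (alpha / beta)^k, where alpha and
   beta are the geometric means of |a| and |b| over one period.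
   If alpha < beta, y is a nonzero summable functional killing the range.
   If alpha > beta, the identity bounds x by T x.  If alpha = beta, y is bounded
   above and below: the range is dense, since a truncated target can be
   corrected by a long block of small entries that makes the pairing with y
   vanish; and preimages with tent-shaped partial sums make the inverse
   unbounded. *)

Require Import Defs.
From mathcomp Require Import all_boot all_order all_algebra.
From mathcomp Require Import complex ring zify.
From mathcomp Require Import all_classical all_reals all_analysis.

Import Order.TTheory GRing.Theory Num.Theory.
Import numFieldNormedType.Exports.

Local Open Scope classical_set_scope.
Local Open Scope ring_scope.

(** * Bidiagonal systems and the adjoint recurrence *)

Definition bidiag {K : fieldType} (a b x : nat -> K) (k : nat) : K :=
  (if k is j.+1 then b j * x j else 0) + a k * x k.

(* Solution of the adjoint equation, see [dual_seqS]. *)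
Definition dual_seq {K : fieldType} (a b : nat -> K) (k : nat) : K :=
  \prod_(j < k) - (a j / b j).

Section Bidiagonal.
Context {K : fieldType} {a b : nat -> K}.
Hypothesis b0 : forall k, b k != 0.

Lemma dual_seqS k : dual_seq a b k.+1 * b k = - (dual_seq a b k * a k).
Proof.
by rewrite /dual_seq big_ord_recr/= mulrN mulNr -mulrA divfK.
Qed.

(** Telescoping: by the adjoint equation, the subdiagonal term of row [n.+1] cancels the sum of the
    preceding rows. *)
Lemma sum_dual_bidiag (x : nat -> K) n :
  \sum_(k < n.+1) dual_seq a b k * bidiag a b x k = dual_seq a b n * a n * x n.
Proof.
elim: n => [|n IH]; first by rewrite big_ord1 /bidiag add0r mulrA.
rewrite big_ord_recr IH /bidiag /= mulrDr mulrA dual_seqS.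
by rewrite mulNr addrA subrr add0r mulrA.
Qed.

Hypothesis a0 : forall k, a k != 0.

Lemma dual_seq_neq0 k : dual_seq a b k != 0.
Proof. by apply/prodf_neq0 => j _; rewrite oppr_eq0 mulf_neq0 ?invr_eq0. Qed.

(** Converse of [sum_dual_bidiag]: partial sums [h] may be prescribed freely. Row 0 has no
    subdiagonal term, hence [h 0 = 0]. *)
Lemma bidiag_primitive (h : nat -> K) k : h 0%N = 0 ->
  bidiag a b (fun k => h k.+1 / (dual_seq a b k * a k)) k =
  (h k.+1 - h k) / dual_seq a b k.
Proof.
move=> h0; rewrite /bidiag; case: k => [|k].
  by rewrite h0 add0r subr0 invfM mulrCA (mulrCA (a 0)) divff ?mulr1.
rewrite -(opprK (dual_seq a b k * a k)) -dual_seqS.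
have := dual_seq_neq0 k.+1; have := b0 k; have := a0 k.+1.
move: (dual_seq _) (b k) (a k.+1) => y u v v0 u0 y0; field.
by rewrite y0 v0 oppr_eq0 mulf_neq0.
Qed.

End Bidiagonal.

(** * Growth of products of periodic sequences *)

Section PeriodicProducts.
Context {K : numFieldType}.
Implicit Types (f g : nat -> K) (c d : K).

Lemma bounded_of_period_nonincreasing f n : (0 < n)%N -> (forall k, 0 <= f k) ->
  (forall k, f (n + k)%N <= f k) -> exists2 M, 0 <= M & forall k, f k <= M.
Proof.
move=> n0 f0 fn; exists (\sum_(i < n) f i); first by rewrite sumr_ge0.
elim/ltn_ind => k IH; have [kn|nk] := ltnP k n.
  by rewrite (bigD1 (Ordinal kn))//= lerDl sumr_ge0.
by rewrite -(subnKC nk); apply: le_trans (fn _) _; apply: IH; lia.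
Qed.

(** Advancing [k] by one period multiplies the quotient by [c ^+ k] by a factor at most 1, so its
    values on the first period control it. *)
Lemma prod_periodic_le f n c : (0 < n)%N -> (forall k, f (n + k)%N = f k) ->
    (forall k, 0 <= f k) -> 0 < c -> \prod_(j < n) f j <= c ^+ n ->
  exists2 M, 0 <= M & forall k, \prod_(j < k) f j <= M * c ^+ k.
Proof.
move=> n0 fn f0 c0 fc.
have p0 k : 0 <= \prod_(j < k) f j by rewrite prodr_ge0.
have [||M M0 fM] := @bounded_of_period_nonincreasing
    (fun k => \prod_(j < k) f j / c ^+ k) n n0.
- by move=> k; rewrite divr_ge0// exprn_ge0// ltW.
- move=> k; rewrite big_split_ord/= exprD invfM mulrACA.
  under [X in _ * (X / _)]eq_bigr do rewrite fn.
  have cX i : 0 < c ^+ i by rewrite exprn_gt0.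
  by rewrite ler_piMl ?divr_ge0 ?ler_pdivrMr ?mul1r// ?p0 ?ltW.
- by exists M => // k; rewrite -ler_pdivrMr ?exprn_gt0.
Qed.

(** The two periods may differ, so numerators and denominators are bounded separately. *)
Lemma prod_ratio_le f g m n c d : (0 < m)%N -> (0 < n)%N ->
    (forall k, f (m + k)%N = f k) -> (forall k, g (n + k)%N = g k) ->
    (forall k, 0 <= f k) -> (forall k, 0 < g k) -> 0 < c -> 0 < d ->
    \prod_(j < m) f j <= c ^+ m -> d ^+ n <= \prod_(j < n) g j ->
  exists2 M, 0 <= M & forall k, \prod_(j < k) (f j / g j) <= M * (c / d) ^+ k.
Proof.
move=> m0 n0 fm gn f0 g0 c0 d0 fc gd.
have [M M0 fM] := @prod_periodic_le f m c m0 fm f0 c0 fc.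
have [||||N N0 gN] := @prod_periodic_le (fun k => (g k)^-1) n d^-1 n0.
- by move=> k; rewrite gn.
- by move=> k; rewrite invr_ge0 ltW.
- by rewrite invr_gt0.
- by rewrite prodfV exprVn lef_pV2 ?posrE ?exprn_gt0 ?prodr_gt0.
exists (M * N) => [|k]; first exact: mulr_ge0.
rewrite big_split/= exprMn mulrACA; apply: ler_pM => //.
- by rewrite prodr_ge0.
- by rewrite prodr_ge0// => i _; rewrite invr_ge0 ltW.
- exact: fM.
- exact: gN.
Qed.

Lemma geometric_sum_lt1 c n : 0 <= c -> c < 1 ->
  \sum_(k < n) c ^+ k <= (1 - c)^-1.
Proof.
move=> c0 c1; have c1' : 0 < 1 - c by rewrite subr_gt0.
rewrite -[leRHS]mul1r ler_pdivlMr// mulrC.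
rewrite -[X in X * _]opprB mulNr -subrX1 opprB.
by rewrite gerBl exprn_ge0.
Qed.

Lemma geometric_sum_gt1 c n : 1 < c ->
  \sum_(k < n.+1) c ^+ k <= c / (c - 1) * c ^+ n.
Proof.
move=> c1; have c1' : 0 < c - 1 by rewrite subr_gt0.
rewrite mulrAC ler_pdivlMr// mulrC -subrX1 -exprS.
by rewrite gerBl.
Qed.

End PeriodicProducts.

Lemma div_double_succ_lt_half {K : numFieldType} (u : K) :
  0 <= u -> u * (2 * (u + 1))^-1 < 2^-1.
Proof.
move=> u0; have u1 : 0 < u + 1 by rewrite ltr_wpDl.
rewrite ltr_pdivrMr ?mulr_gt0// mulrA mulVf ?pnatr_eq0// mul1r.
by rewrite ltrDl.
Qed.

Lemma dense_normP (K : numFieldType) (X : normedModType K) (A : set X) :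
  dense A <-> forall x e, 0 < e -> exists2 y, A y & `|x - y| < e.
Proof.
split=> [dA x e e0|dA O [x Ox] oO].
  have [|y [xy Ay]] := dA (ball x e) _ (ball_open x e).
    by exists x; exact: ballxx.
  by exists y => //; move: xy; rewrite -ball_normE.
have /nbhs_ballP[e /= e0 xO] : nbhs x O by exact: open_nbhs_nbhs.
have [y Ay xy] := dA x e e0; exists y; split=> //.
by apply: xO; rewrite -ball_normE.
Qed.

Lemma complex_archi {R : realType} (z : R[i]) : exists n : nat, `|z| <= n%:R.
Proof.
exists (Num.bound (cmod z)).
rewrite normr_cmod -(rmorph_nat (real_complex R)) lecR ltW//.
by rewrite archi_boundP// cmod_ge0.
Qed.

Lemma finite_support_c0 {R : realType} {x : nat -> R[i]} n :
  (forall k, (n <= k)%N -> x k = 0) -> x \in @c0_pred R.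
Proof.
by move=> x0; rewrite c0_predE; apply: cvg_near_cst; exists n.
Qed.

(** * Range and inverse of a bidiagonal operator, from bounds on [y] *)

Section BidiagonalOperator.
Context {R : realType}.
Variables (a b : nat -> R[i]) (S : c0 R -> c0 R).
Hypothesis SE : forall x k, S x k = bidiag a b x k.
Hypothesis b0 : forall k, b k != 0.
Let y := dual_seq a b.

(** The first unit vector pairs with [y] to 1, whereas vectors in the range pair to 0. Diagonal
    entries may vanish here. *)
Lemma bidiag_range_not_dense (A B : R[i]) :
  (forall k, `|a k| <= A) -> (forall n, \sum_(k < n) `|y k| <= B) ->
  ~ dense (range S).
Proof.
move=> aA yB /dense_normP dS.
have A0 : 0 <= A := le_trans (normr_ge0 _) (aA 0%N).
have B_ge0 : 0 <= B := le_trans (sumr_ge0 _ (fun=> fun=> normr_ge0 _)) (yB 0%N).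
have B1 : 0 < B + 1 by rewrite ltr_wpDl.
have AB : 0 < B * A + 1 by rewrite ltr_wpDl// mulr_ge0.
have yB1 k : `|y k| <= B.
  by apply: le_trans (yB k.+1); rewrite big_ord_recr/= lerDr sumr_ge0.
have e0P : (fun k => (k == 0%N)%:R : R[i]) \in @c0_pred R.
  by apply: (finite_support_c0 1) => -[].
(* Replacing the unit vector by [S x] then changes the pairing by at most [B * e < 1/2]; the [+ 1]
   covers [B = 0]. *)
pose e := (2 * (B + 1))^-1.
have e0 : 0 < e by rewrite invr_gt0 mulr_gt0.
have [_ [x _ <-] xe] := dS (C0 e0P) e e0.
(* The boundary term [y n * a n * x n] of the finite pairing must also fall below 1/2. *)
have xn0 : \forall n \near \oo, `|x n| < (2 * (B * A + 1))^-1.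
  have /cvgr0Pnorm_lt := c0_cvg x; apply.
  by rewrite invr_gt0 mulr_gt0.
have [n _ /(_ n (leqnn n)) xn] := xn0.
have le1 : `|1 - y n * a n * x n| < 2^-1.
  rewrite -(sum_dual_bidiag b0).
  have e0y : \sum_(k < n.+1) y k * C0 e0P k = 1.
    rewrite big_ord_recl/= big1 ?addr0; last by move=> i _; rewrite mulr0.
    by rewrite /y /dual_seq big_ord0 mulr1.
  rewrite -[X in `|X - _|]e0y -sumrB.
  apply: le_lt_trans (ler_norm_sum _ _ _) _.
  apply: (@le_lt_trans _ _ (B * e)).
    apply: le_trans (_ : \sum_(k < n.+1) `|y k| * e <= _).
      apply: ler_sum => k _; rewrite -SE -mulrBr normrM ler_wpM2l//.
      by rewrite (le_trans _ (ltW xe))// (c0_norm_ub (C0 e0P - S x)).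
    by rewrite -mulr_suml ler_wpM2r// ltW.
  exact: div_double_succ_lt_half.
have le2 : `|y n * a n * x n| < 2^-1.
  apply: (@le_lt_trans _ _ (B * A * (2 * (B * A + 1))^-1)).
    by rewrite !normrM !ler_pM ?mulr_ge0//; exact: ltW.
  by rewrite div_double_succ_lt_half// mulr_ge0.
have : `|1 : R[i]| < 1.
  rewrite -{1}(subrK (y n * a n * x n) 1).
  apply: le_lt_trans (ler_normD _ _) _.
  by rewrite [ltRHS]splitr !mul1r ltrD.
by rewrite normr1 ltxx.
Qed.

Hypothesis a0 : forall k, a k != 0.

(** Dividing [sum_dual_bidiag] by [y n * a n] bounds each [x n] by [D] times the norm of [S x]. *)
Lemma bidiag_bounded_inverse (D : R[i]) :
  (forall n, \sum_(k < n.+1) `|y k| <= D * `|y n * a n|) -> bounded_inverse S.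
Proof.
move=> yD; exists D => z Sz.
have Sx : S (pinv setT S z) = z by exact: pinvK (mem_set Sz).
move: (pinv _ _ _) Sx => x <-; apply: c0_norm_le => n.
have ya : 0 < `|y n * a n| by rewrite normr_gt0 mulf_neq0// dual_seq_neq0.
rewrite -(ler_pM2l ya) -normrM -(sum_dual_bidiag b0).
rewrite mulrA [X in _ <= X * _]mulrC.
apply: le_trans (_ : (\sum_(k < n.+1) `|y k|) * `|S x| <= _); last first.
  by rewrite ler_wpM2r.
rewrite mulr_suml; apply: le_trans (ler_norm_sum _ _ _) _.
by apply: ler_sum => k _; rewrite normrM ler_wpM2l// -SE c0_norm_ub.
Qed.

Lemma bidiag_injective : injective S.
Proof.
move=> x x' Sxx'; apply/val_inj/funext => n /=.
have ya : y n * a n != 0 by rewrite mulf_neq0// dual_seq_neq0.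
apply: (mulfI ya); rewrite -!(sum_dual_bidiag b0).
by apply: eq_bigr => k _; rewrite -!SE Sxx'.
Qed.

(* [h k] is the sum of [y j * S x j] over [j < k]; finite support of [h] is what
   puts [x] in c_0. *)
Lemma bidiag_preimage (h : nat -> R[i]) n :
  h 0%N = 0 -> (forall k, (n < k)%N -> h k = 0) ->
  exists x : c0 R, (forall k, x k = h k.+1 / (y k * a k)) /\
            (forall k, S x k = (h k.+1 - h k) / y k).
Proof.
move=> h0 hn.
have xP : (fun k => h k.+1 / (y k * a k)) \in @c0_pred R.
  by apply: (finite_support_c0 n) => k nk; rewrite hn// mul0r.
exists (C0 xP); split=> // k.
by rewrite SE -(bidiag_primitive b0 a0).
Qed.

Lemma bidiag_range_dense (m : R[i]) : 0 < m -> (forall k, m <= `|y k|) ->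
  dense (range S).
Proof.
move=> m0 ym; apply/dense_normP => z e e0.
have e40 : 0 < e / 4 by rewrite divr_gt0.
have : \forall n \near \oo, `|z n| < e / 4.
  by have /cvgr0Pnorm_lt := c0_cvg z; apply.
move=> [n _ zn].
pose H k := \sum_(j < k) y j * z j.
(* This [L] makes each step of the ramp from [H n] to 0, once divided by [y k], at most [e / 4]. *)
have [L HL] := complex_archi (H n / m / (e / 4)).
have L1 : 0 < (L.+1%:R : R[i]) by rewrite ltr0n.
(* Interpolating linearly from [H n] to 0 perturbs [z] by [O(1/L)] only. *)
pose h k := if (k <= n)%N then H k else (n + L.+1 - k)%:R / L.+1%:R * H n.
have [||x [_ Sx]] := bidiag_preimage h (n + L.+1).
- by rewrite /h /H big_ord0.
- move=> k nk; rewrite /h leqNgt (leq_trans _ nk) ?ltnS ?leq_addr//=.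
  by rewrite (eqP (ltnW nk)) !mul0r.
exists (S x); first by exists x.
apply: le_lt_trans (_ : e / 4 + e / 4 < _); last first.
  rewrite -mulrDr gtr_pMr// -mulr2n -[X in X < _]mulr_natl.
  by rewrite ltr_pdivrMr// mul1r ltr_nat.
apply: c0_norm_le => k.
have -> : (z - S x) k = z k - S x k by [].
(* Before [n], [S x] equals [z]; from [n] on, the tail of [z] and the ramp each contribute at most
   [e / 4]. *)
rewrite Sx; have [kn|nk] := ltnP k n.
  rewrite /h kn ltnW// /H big_ord_recr/= addrAC subrr add0r.
  rewrite mulrAC divff ?dual_seq_neq0// mul1r subrr normr0.
  by rewrite addr_ge0// ltW.
apply: le_trans (ler_normB _ _) _; apply: lerD; first by rewrite ltW// zn.
(* Both branches of [h] agree at [k = n], so the ramp formula is valid there too. *)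
have -> : h k = (n + L.+1 - k)%:R / L.+1%:R * H n.
  rewrite /h; case: ifP => // kn.
  have -> : k = n by apply/eqP; rewrite eqn_leq kn.
  by rewrite addKn divff ?gt_eqF// mul1r.
rewrite {1}/h ltnNge nk /= -mulrBl -mulrBl.
rewrite normrM normfV ler_pdivrMr; last exact: lt_le_trans (ym k).
apply: (@le_trans _ _ (e / 4 * m)); last by rewrite ler_wpM2l// ltW.
rewrite -ler_pdivrMr// !normrM normfV (ger0_norm (ltW L1)).
have d1 : `|(n + L.+1 - k.+1)%:R - (n + L.+1 - k)%:R : R[i]| <= 1.
  rewrite distrC -natrB; last by apply: leq_sub2l.
  by rewrite ger0_norm// lern1; lia.
apply: (@le_trans _ _ (L.+1%:R^-1 * `|H n| / m)).
  rewrite ler_wpM2r ?invr_ge0 ?(ltW m0)// ler_wpM2r//.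
  by rewrite ler_piMl// invr_ge0 ltW.
rewrite -mulrA mulrC ler_pdivrMr// [leRHS]mulrC -ler_pdivrMr//.
apply: le_trans (_ : L%:R <= _); last by rewrite ler_nat.
apply: le_trans HL; rewrite normrM normfV (ger0_norm (ltW e40)).
by rewrite normrM normfV (ger0_norm (ltW m0)).
Qed.

Lemma bidiag_unbounded_inverse (A m M : R[i]) : 0 < m ->
  (forall k, `|a k| <= A) -> (forall k, m <= `|y k| <= M) ->
  ~ bounded_inverse S.
Proof.
move=> m0 aA ymM [B SB].
have y0 k : 0 < `|y k| by apply: lt_le_trans m0 _; case/andP: (ymM k).
have M0 : 0 < M by apply: lt_le_trans (y0 0%N) _; case/andP: (ymM 0%N).
have A0 : 0 < A by apply: lt_le_trans (aA 0%N); rewrite normr_gt0.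
(* Boundedness would force [L + 1] below the modulus of this number, hence [L + 1 <= L]. *)
have [L BL] := complex_archi (B * m^-1 * (M * A)).
(* A tent of slope 1 and height [L + 1]: the slope keeps [S x] bounded by [m^-1], while the peak
   makes [x L] of order [L]. *)
pose h k : R[i] := (minn k (L.+1.*2 - k))%:R.
have [||x [xh Sx]] := bidiag_preimage h L.+1.*2.
- by rewrite /h min0n.
- by move=> k nk; rewrite /h (eqP (ltnW nk)) minn0.
have Sx1 : `|S x| <= m^-1.
  apply: c0_norm_le => k; rewrite Sx normrM normfV -[leRHS]mul1r.
  rewrite ler_pM ?invr_ge0//; last first.
    by rewrite lef_pV2 ?posrE//; case/andP: (ymM k).
  have [le|le] := leqP (minn k (L.+1.*2 - k)) (minn k.+1 (L.+1.*2 - k.+1)).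
    by rewrite /h -natrB// ger0_norm// lern1; lia.
  by rewrite /h distrC -natrB ?(ltnW le)// ger0_norm// lern1; lia.
have := SB (S x) (ex_intro2 _ _ x I erefl).
have -> : pinv setT S (S x) = x.
  by apply: bidiag_injective; apply: pinvK; apply: mem_set; exists x.
move=> xB.
have Lx : L.+1%:R / (M * A) <= `|x|.
  apply: le_trans (c0_norm_ub x L); rewrite xh /h.
  have -> : minn L.+1 (L.+1.*2 - L.+1) = L.+1 by lia.
  rewrite normrM normfV normrM ger0_norm// ler_wpM2l//.
  rewrite lef_pV2 ?posrE ?mulr_gt0 ?normr_gt0 ?dual_seq_neq0//.
  by rewrite ler_pM//; case/andP: (ymM L).
(* [B] is an arbitrary complex number, but the inequality makes [B] times the norm of [S x] real and
   nonnegative, so taking moduli is harmless. *)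
have {}xB : `|x| <= `|B| * m^-1.
  apply: le_trans (ler_wpM2l (normr_ge0 B) Sx1).
  rewrite -[`|x|]ger0_norm// (le_trans (_ : _ <= `|B * `|S x| |))//.
    by rewrite !ger0_norm// (le_trans _ xB).
  by rewrite normrM normr_id.
suff : (L.+1%:R : R[i]) <= L%:R by rewrite ler_nat ltnn.
have := le_trans Lx xB; rewrite ler_pdivrMr ?mulr_gt0// => /le_trans; apply.
apply: le_trans BL; rewrite !normrM normfV.
by rewrite (gtr0_norm m0) (gtr0_norm M0) (gtr0_norm A0).
Qed.

End BidiagonalOperator.

(** * Periodic coefficients: comparing the geometric means [A] and [B] *)

Section PeriodicBidiagonalOperator.
Context {R : realType} {a b : nat -> R[i]} {S : c0 R -> c0 R}.
Hypothesis SE : forall x k, S x k = bidiag a b x k.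
Hypothesis b0 : forall k, b k != 0.
Context {m n : nat} {A B : R[i]}.
Hypotheses (m0 : (0 < m)%N) (n0 : (0 < n)%N).
Hypothesis am : forall k, a (m + k)%N = a k.
Hypothesis bn : forall k, b (n + k)%N = b k.
Hypotheses (A0 : 0 <= A) (B0 : 0 < B).
Hypothesis aA : \prod_(j < m) `|a j| = A ^+ m.
Hypothesis bB : \prod_(j < n) `|b j| = B ^+ n.
Let y := dual_seq a b.

Let b_gt0 k : 0 < `|b k|. Proof. by rewrite normr_gt0. Qed.

Let normam k : `|a (m + k)%N| = `|a k|. Proof. by rewrite am. Qed.

Let normbn k : `|b (n + k)%N| = `|b k|. Proof. by rewrite bn. Qed.

Let a_bounded : exists2 M : R[i], 0 <= M & forall k, `|a k| <= M.
Proof.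
apply: (bounded_of_period_nonincreasing (fun k => `|a k|) m) => // k.
by rewrite am.
Qed.

Let norm_y k : `|y k| = \prod_(j < k) (`|a j| / `|b j|).
Proof.
rewrite /y /dual_seq normr_prod; apply: eq_bigr => j _.
by rewrite normrN normrM normfV.
Qed.

Let y_le (c : R[i]) : A <= c -> 0 < c ->
  exists2 M : R[i], 0 <= M & forall k, `|y k| <= M * (c / B) ^+ k.
Proof.
move=> Ac c_gt0.
have [|||M M0 yM] := prod_ratio_le (fun k => `|a k|) (fun k => `|b k|) m n c B
    m0 n0 normam normbn _ b_gt0 c_gt0 B0; rewrite ?aA ?bB//.
  by rewrite lerXn2r// nnegrE ltW.
by exists M => // k; rewrite norm_y.
Qed.

Lemma periodic_range_not_dense : A < B -> ~ dense (range S).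
Proof.
(* The midpoint is positive even if [A = 0], and [c / B < 1] makes [y] summable. *)
move=> AB; pose c := (A + B) / 2.
have [Ac cB] : A < c /\ c < B by have [] := midf_lt AB.
have c_gt0 : 0 < c := le_lt_trans A0 Ac.
have [M M0 yM] := y_le _ (ltW Ac) c_gt0.
have [N N0 aN] := a_bounded.
apply: (bidiag_range_not_dense _ _ _ SE b0 N (M * (1 - c / B)^-1) aN) => k.
apply: (@le_trans _ _ (\sum_(j < k) M * (c / B) ^+ j)).
  exact: ler_sum.
rewrite -mulr_sumr ler_wpM2l// geometric_sum_lt1//.
  by rewrite divr_ge0 ?ltW.
by rewrite ltr_pdivrMr// mul1r.
Qed.

Hypothesis A_gt0 : 0 < A.

(** A zero entry would make the product over a period vanish, against [A > 0]. *)
Let a0 k : a k != 0.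
Proof.
elim/ltn_ind: k => k IH; have [km|mk] := ltnP k m; last first.
  by rewrite -(subnKC mk) am; apply: IH; lia.
have : \prod_(j < m) `|a j| != 0 by rewrite aA expf_neq0// gt_eqF.
by move/prodf_neq0 => /(_ (Ordinal km) isT); rewrite normr_eq0.
Qed.

(** The upper estimate with the roles of [a] and [b] exchanged. *)
Let y_ge : exists2 M : R[i], 0 <= M & forall k, `|y k|^-1 <= M * (B / A) ^+ k.
Proof.
have a_gt0 k : 0 < `|a k| by rewrite normr_gt0.
have [|||M M0 yM] := prod_ratio_le (fun k => `|b k|) (fun k => `|a k|) n m B A
    n0 m0 normbn normam _ a_gt0 B0 A_gt0; rewrite ?aA ?bB//.
exists M => // k; rewrite norm_y -prodfV (le_trans _ (yM k))//.
rewrite le_eqVlt; apply/orP; left; apply/eqP/eq_bigr => j _.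
by rewrite invf_div.
Qed.

Lemma periodic_bounded_inverse : B < A -> bounded_inverse S.
Proof.
move=> BA; have [M M0 yM] := y_le _ (lexx A) A_gt0.
have [N N0 yN] := y_ge.
have [||Q Q0 aQ] := bounded_of_period_nonincreasing (fun k => `|a k|^-1) m m0.
- by move=> k; rewrite invr_ge0.
- by move=> k; rewrite am.
pose t := A / B.
have t1 : 1 < t by rewrite ltr_pdivlMr// mul1r.
have t0 : 0 < t := lt_trans ltr01 t1.
pose g := t / (t - 1).
have g0 : 0 <= g by rewrite divr_ge0 ?subr_ge0 ?(ltW t0) ?(ltW t1).
(* For [t > 1] the geometric sum is at most [g] times its last term; [N] compares that term with
   [y k], and [Q] bounds the inverses of the diagonal entries. *)
apply: (bidiag_bounded_inverse _ _ _ SE b0 a0 (M * (g * (N * Q)))) => k.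
apply: (@le_trans _ _ (\sum_(j < k.+1) M * t ^+ j)); first exact: ler_sum.
rewrite -mulr_sumr -(mulrA M) ler_wpM2l//.
apply: le_trans (geometric_sum_gt1 t k t1) _.
rewrite -/g -(mulrA g) ler_wpM2l//.
have y_gt0 : 0 < `|y k| by rewrite normr_gt0 dual_seq_neq0.
have a_gt0 : 0 < `|a k| by rewrite normr_gt0.
have le1 : t ^+ k <= N * `|y k|.
  have := yN k; rewrite -(invf_div A B) exprVn -/t.
  by rewrite ler_pdivlMr ?exprn_gt0// mulrC ler_pdivrMr.
have le2 : 1 <= Q * `|a k|.
  by rewrite -ler_pdivrMr// div1r.
rewrite normrM mulrACA -[leLHS]mulr1.
by apply: ler_pM => //; rewrite exprn_ge0 ?ltW.
Qed.

Lemma periodic_continuous_spectrum : A = B ->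
  [/\ injective S, dense (range S) & ~ bounded_inverse S].
Proof.
move=> AB; have BA1 : B / A = 1 by rewrite AB divff ?gt_eqF.
have [M M0 yM] := y_le _ (lexx A) A_gt0.
have [N N0 yN] := y_ge.
have [Q Q0 aQ] := a_bounded.
(* With [A = B] the geometric factors are 1, so [y] is bounded above and away from 0. *)
have {}yM k : `|y k| <= M.
  by apply: le_trans (yM k) _; rewrite -AB divff ?gt_eqF// expr1n mulr1.
have {}yN k : `|y k|^-1 <= N.
  by apply: le_trans (yN k) _; rewrite BA1 expr1n mulr1.
have y_gt0 k : 0 < `|y k| by rewrite normr_gt0 dual_seq_neq0.
have N_gt0 : 0 < N by apply: lt_le_trans (yN 0%N); rewrite invr_gt0.
have yNV k : N^-1 <= `|y k|.
  by rewrite -[leRHS]invrK lef_pV2 ?posrE ?invr_gt0.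
have NV_gt0 : 0 < N^-1 by rewrite invr_gt0.
split.
- exact: (bidiag_injective _ _ _ SE b0 a0).
- exact: (bidiag_range_dense _ _ _ SE b0 a0 _ NV_gt0 yNV).
- apply: (bidiag_unbounded_inverse _ _ _ SE b0 a0 _ _ M NV_gt0 aQ) => k.
  by rewrite yNV yM.
Qed.

End PeriodicBidiagonalOperator.

(** * Geometric means as real powers, and the spectrum *)

Lemma powR_invn_expr (R : realType) (u : R) n : (0 < n)%N -> 0 <= u ->
  (u `^ n%:R^-1) ^+ n = u.
Proof.
move=> n0 u0; rewrite -powR_mulrn ?powR_ge0// -powRrM mulVf ?powRr1//.
by rewrite pnatr_eq0 -lt0n.
Qed.

Lemma prod_normr_cmod {R : rcfType} n (f : 'I_n -> R[i]) :
  \prod_(i < n) `|f i| = (\prod_(i < n) cmod (f i))%:C%C.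
Proof. by rewrite rmorph_prod. Qed.

Theorem theorem3p7 (R : realType) (l l' : nat)
    (r : l.-tuple R[i]) (s : l'.-tuple R[i])
    (l_ge1 : (1 <= l)%N) (l'_ge1 : (1 <= l')%N)
    (s_neq0 : forall i : 'I_l', tnth s i != 0) :
  continuous_spectrum (bidiag_op r s) =
  [set lambda : R[i] |
     (\prod_(i < l) cmod (lambda - tnth r i)) `^ (l%:R)^-1 =
     (\prod_(i < l') cmod (tnth s i)) `^ (l'%:R)^-1].
Proof.
apply/funext => lambda.
pose a k := r`_(k %% l) - lambda; pose b k := s`_(k %% l').
pose S := fun x : c0 R => bidiag_op r s x - lambda *: x.
have SE x k : S x k = bidiag a b x k.
  have -> : S x k = bidiag_act r s x k - lambda * x k by [].
  by rewrite /bidiag_act /bidiag mulrBl addrA.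
have b0 k : b k != 0.
  have kl : (k %% l' < l')%N by rewrite ltn_mod.
  by have := s_neq0 (Ordinal kl); rewrite (tnth_nth 0).
have al k : a (l + k)%N = a k by rewrite /a modnDl.
have bl' k : b (l' + k)%N = b k by rewrite /b modnDl.
rewrite /=; set u := \prod_(i < l) _; set v := \prod_(i < l') _.
have u0 : 0 <= u by rewrite prodr_ge0// => i _; exact: cmod_ge0.
have v0 : 0 < v.
  by rewrite prodr_gt0// => i _; rewrite -ltcR -normr_cmod normr_gt0.
set A := u `^ _; set B := v `^ _.
have A0 : 0 <= A%:C%C by rewrite lecR powR_ge0.
have B0 : 0 < B%:C%C by rewrite ltcR powR_gt0.
have aA : \prod_(j < l) `|a j| = A%:C%C ^+ l.
  rewrite -rmorphXn/= powR_invn_expr// -prod_normr_cmod.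
  by apply: eq_bigr => i _; rewrite /a modn_small// -tnth_nth distrC.
have bB : \prod_(j < l') `|b j| = B%:C%C ^+ l'.
  rewrite -rmorphXn/= powR_invn_expr ?(ltW v0)// -prod_normr_cmod.
  by apply: eq_bigr => i _; rewrite /b modn_small// -tnth_nth.
apply/propext; split=> [[_ dS nS]|AB]; last first.
  apply: (periodic_continuous_spectrum SE b0 l_ge1 l'_ge1 al bl' A0 B0 aA bB);
    by rewrite AB.
(* [B < A] would give a bounded inverse, [A < B] a range that is not dense. *)
apply/eqP; rewrite eq_le !leNgt; apply/andP; split; apply/negP => AB.
  apply: nS.
  apply: (periodic_bounded_inverse SE b0 l_ge1 l'_ge1 al bl' A0 B0 aA bB).
    by rewrite ltcR (le_lt_trans _ AB)// powR_ge0.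
  by rewrite ltcR.
apply: (periodic_range_not_dense SE b0 l_ge1 l'_ge1 al bl' A0 B0 aA bB) dS.
by rewrite ltcR.
Qed.
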